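(* For every real $\beta>1$, the predecessor set sequence of the $\beta$-shift $X_\beta$ equals the complexity sequence of $d_\beta^*(1)$; that is, $|P_{X_\beta}(n)|=\Phi_n(d_\beta^*(1))$ for every positive integer $n$.
   Context: Let $\beta>1$ be real. For $x\in[0,1)$, $d_\beta(x)=.x_1x_2x_3\ldots$ is the lexicographically largest sequence over $\{0,1,\ldots,\lfloor\beta\rfloor\}$ with $x=\sum_{n\ge1}x_n\beta^{-n}$ (the greedy expansion, $x_i=\lfloor \beta\, T_\beta^{i-1}(x)\rfloor$ with $T_\beta(x)=\beta x \bmod 1$). The one-sided $\beta$-shift is $X_\beta=\overline{d_\beta([0,1))}$ (closure in the product topology). Put $d_\beta^*(1)=\lim_{x\nearrow 1}d_\beta(x)$. Equivalently (Parry), a sequence $x$ over $\{0,\ldots,\lfloor\beta\rfloor\}$ is in $X_\beta$ iff $\sigma^i(x)\preceq d_\beta^*(1)$ for all $i\ge 0$, where $\sigma$ is the left shift and $\preceq$ is lexicographic order. For a shift $X$, $L(X)$ is the set of finite words appearing in points of $X$, and $L_n(X)$ is the set of those of length $n$. The predecessor set of $w\in L(X)$ is $P_X(w)=\{s\in L(X): sw\in L(X)\}$. For a positive integer $n$, $P_X(n)=\{P_X(w): w\in L_n(X)\}$, so $|P_X(n)|$ is the number of distinct predecessor sets of words of length $n$; $\{|P_X(n)|\}_{n\ge 1}$ is the predecessor set sequence of $X$. For a right-infinite sequence $d$, $\Phi_n(d)$ is the number of distinct words of length $n$ occurring as (contiguous) subwords of $d$; $\{\Phi_n(d)\}_{n\ge1}$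 is the complexity sequence of $d$. *)

(* Defs.v *)
From HB Require Import structures.
From mathcomp Require Import all_boot all_order all_algebra finmap.
From mathcomp Require Import all_classical all_reals all_analysis.

Set Implicit Arguments.
Unset Strict Implicit.
Unset Printing Implicit Defensive.

Import Order.TTheory GRing.Theory Num.Theory.
Import numFieldNormedType.Exports.

Local Open Scope classical_set_scope.
Local Open Scope ring_scope.

Section Words.
Variable A : finType.
Implicit Types (d : nat -> A) (X : set (nat -> A)) (w : seq A) (n : nat).

Definition occurs w d : Prop :=
  exists i, w = mkseq (fun j => d (i + j)%N) (size w).

Definition complexity d n : nat :=
  #|[pred w : n.-tuple A | `[< occurs w d >]]|.

Definition language X : set (seq A) := [set w | exists2 x, X x & occurs w x].

Definition predecessor_set X w : set (seq A) :=
  [set s | language X s /\ language X (s ++ w)].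

Definition predecessor_sets X n : {fset set (seq A)} :=
  [fset predecessor_set X (tval w)
    | w in [pred w : n.-tuple A | `[< language X w >]]]%fset.

Definition predecessor_set_sequence X n : nat := #|` predecessor_sets X n|%fset.

End Words.

HB.instance Definition _ (b : nat) := isPointed.Build 'I_b.+1 ord0.

(* The alphabet {0, ..., b} with the discrete topology. *)
Definition digit (b : nat) := discrete_topology 'I_b.+1.
HB.instance Definition _ b := DiscreteTopology.on (digit b).
HB.instance Definition _ b := Pointed.on (digit b).

Definition digit_seq (b : nat) := prod_topology (fun _ : nat => digit b).
HB.instance Definition _ b := Pointed.on (digit_seq b).
HB.instance Definition _ b := Nbhs.on (digit_seq b).
HB.instance Definition _ b := Topological.on (digit_seq b).

Definition lex_le (b : nat) (s t : digit_seq b) : bool :=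
  big_lexi_le (fun _ (i j : 'I_b.+1) => (i <= j)%N) s t.

Section BetaShift.
Variables (R : realType) (beta : R).

(* [Num.truncn beta] is the floor of beta as a natural number (for 0 <= beta). *)
Local Notation beta_seq := (digit_seq (Num.truncn beta)).

(* Sequences are indexed from 0: [s k] is the digit x_(k+1). *)
Definition expands (x : R) (s : beta_seq) : Prop :=
  series (fun k => (s k : 'I__)%:R / beta ^+ k.+1) @ \oo --> x.

(* The lexicographically largest expansion; an arbitrary value when there is
   none, which does not happen for 1 < beta and x in [0, 1). *)
Definition d_beta (x : R) : beta_seq :=
  get [set s | expands x s /\ forall t, expands x t -> lex_le t s].

Definition beta_shift : set beta_seq := closure (d_beta @` `[0, 1[).

(* The sequence d_beta^*(1). *)
Definition d_beta_star1 : beta_seq := lim (d_beta x @[x --> 1^'-]).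

End BetaShift.

Arguments beta_shift {R} beta.
Arguments d_beta_star1 {R} beta.

(* Main.v *)
(** Write T for the greedy map on [0, 1) and S for its left-limit version on
    (0, 1], so that d_beta^*(1) lists the digits of 1 under S. Call w reachable
    below t when w is the greedy word of some y in [0, t). Then w belongs to the
    language iff it is reachable below 1, in which case it is reachable below t
    iff it is lexicographically at most the S-word of t of the same length.
    Shifting by s maps the cylinder of s onto an interval [0, t) with t in the
    S-orbit of 1, and each point of the orbit arises in this way; hence the
    predecessor set of w amounts to the set of subwords of d_beta^*(1) of
    length |w|, by position, that are at least w. It is thus unchanged when w is
    replaced by the least such subword, and it separates the subwords. *)

Require Import Defs.
From mathcomp Require Import all_boot all_order all_algebra finmap.
From mathcomp Require Import all_classical all_reals all_analysis.
From mathcomp Require Import ring lra.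

Set Implicit Arguments.
Unset Strict Implicit.
Unset Printing Implicit Defensive.

Import Order.TTheory GRing.Theory Num.Theory.
Import numFieldNormedType.Exports.
Local Open Scope classical_set_scope.
Local Open Scope ring_scope.

(** * Cylinders and coordinatewise convergence of digit sequences *)

Section DigitSeqTopology.
Variable b : nat.

Lemma nbhs_cylinder (s : digit_seq b) n :
  nbhs s [set t : digit_seq b | forall k, (k < n)%N -> t k = s k].
Proof.
elim: n => [|n IH]; first by apply: filterS filterT.
have pn : nbhs s [set t : digit_seq b | t n = s n].
  have := @proj_continuous nat (fun=> digit b) n s [set s n].
  by apply; exact: discrete_set1.
apply: filterS (filterI IH pn) => t [tk tn] k.
by rewrite ltnS leq_eqVlt => /predU1P[->|/tk].
Qed.

Lemma digit_seq_hausdorff : hausdorff_space (digit_seq b).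
Proof. by apply: hausdorff_product => _; exact: discrete_hausdorff. Qed.

Lemma digit_seq_cvg (F : set_system (digit_seq b)) (s : digit_seq b) :
  Filter F -> (forall k, F [set t | t k = s k]) -> F --> s.
Proof.
move=> FF Fk; apply/cvg_sup => k U [_ [[B oB <-] /= Bs] BU].
by apply: filterS (Fk k) => t tk; apply: BU; rewrite /= /proj tk.
Qed.

End DigitSeqTopology.

Section Expansions.
Context {R : realType} (beta : R).
Hypothesis beta_gt1 : 1 < beta.
Local Notation A := 'I_(Num.truncn beta).+1.

(** * The greedy map on [0, 1) and its left-limit version on (0, 1] *)

Definition floor_digit (x : R) : A := inord (Num.truncn (beta * x)).
Definition beta_map (x : R) : R := beta * x - (floor_digit x)%:R.
Definition greedy_word n x := map floor_digit (traject beta_map x n).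

(** The largest integer strictly below [beta * t]; for t in (0, 1] it is nonnegative and at most the
    floor of beta, so neither the absolute value nor [inord] alters it. *)
Definition ceil_digit (t : R) : A := inord `|Num.ceil (beta * t) - 1|%N.
Definition ceil_map (t : R) : R := beta * t - (ceil_digit t)%:R.
Definition quasi_word n t := map ceil_digit (traject ceil_map t n).

Let beta_gt0 : 0 < beta. Proof. exact: lt_trans beta_gt1. Qed.

Lemma floor_digit_eq x (a : A) :
  a%:R <= beta * x < a%:R + 1 -> floor_digit x = a.
Proof.
move=> ax; apply: val_inj; rewrite /floor_digit.
by rewrite (@truncn_def _ (beta * x) a) ?inord_val// -natr1.
Qed.

Lemma floor_digit_itv x : 0 <= x < 1 ->
  (floor_digit x)%:R <= beta * x < (floor_digit x)%:R + 1.
Proof.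
move=> /andP[x0 x1]; rewrite /floor_digit inordK; last first.
  by rewrite ltnS le_truncn// ger_pMr// ltW.
by rewrite natr1; apply: truncn_itv; rewrite mulr_ge0// ltW.
Qed.

Lemma beta_map_itv x : 0 <= x < 1 -> 0 <= beta_map x < 1.
Proof. by move=> /floor_digit_itv; rewrite /beta_map; lra. Qed.

Lemma ceil_digit_itv t : 0 < t <= 1 ->
  (ceil_digit t)%:R < beta * t <= (ceil_digit t)%:R + 1.
Proof.
move=> /andP[t0 t1]; have := ceil_itv (beta * t).
have z0 : 0 < beta * t by rewrite mulr_gt0.
have : 0 <= Num.ceil (beta * t) - 1 by rewrite subr_ge0 -gtz0_ge1 ceil_gt0.
rewrite /ceil_digit.
case: (Num.ceil (beta * t) - 1) (subrK 1 (Num.ceil (beta * t))) => // k <- _.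
rewrite intrD /= => /andP[ltk kle]; rewrite inordK ?ltk//.
rewrite ltnS truncn_ge_nat ?(ltW beta_gt0)//.
by rewrite (le_trans (ltW ltk))// ger_pMr.
Qed.

Lemma ceil_map_itv t : 0 < t <= 1 -> 0 < ceil_map t <= 1.
Proof. by move=> /ceil_digit_itv; rewrite /ceil_map; lra. Qed.

Lemma iter_beta_map_itv k x : 0 <= x < 1 -> 0 <= iter k beta_map x < 1.
Proof. by move=> x01; elim: k => //= k; exact: beta_map_itv. Qed.

Lemma iter_ceil_map_itv k t : 0 < t <= 1 -> 0 < iter k ceil_map t <= 1.
Proof. by move=> t01; elim: k => //= k; exact: ceil_map_itv. Qed.

Lemma size_greedy_word n x : size (greedy_word n x) = n.
Proof. by rewrite size_map size_traject. Qed.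

Lemma size_quasi_word n t : size (quasi_word n t) = n.
Proof. by rewrite size_map size_traject. Qed.

(** * Reachability of words below a cut *)

Definition reach (w : seq A) (t : R) :=
  exists2 y, 0 <= y < t & greedy_word (size w) y = w.

Lemma natr_ord_succ (a c : A) : (a < c)%N -> a%:R + 1 <= c%:R :> R.
Proof. by move=> ac; rewrite natr1 ler_nat. Qed.

Lemma greedy_word_cons (a : A) n y : 0 <= y < 1 ->
  greedy_word n.+1 ((a%:R + y) / beta) = a :: greedy_word n y.
Proof.
move=> y01; have bK : beta * ((a%:R + y) / beta) = a%:R + y.
  by rewrite mulrCA divff ?gt_eqF// mulr1.
have fd : floor_digit ((a%:R + y) / beta) = a.
  by apply: floor_digit_eq; rewrite bK; lra.
by rewrite /greedy_word /= fd /beta_map fd bK addrC addKr.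
Qed.

Lemma reach_cons (a : A) w t y : 0 <= y < 1 -> greedy_word (size w) y = w ->
  a%:R + y < beta * t -> reach (a :: w) t.
Proof.
move=> y01 yw ayt; exists ((a%:R + y) / beta).
  rewrite ltr_pdivrMr// (mulrC t) ayt divr_ge0 ?(ltW beta_gt0)// addr_ge0//.
  by case/andP: y01.
by rewrite greedy_word_cons// yw.
Qed.

(** Since a + 1 <= [ceil_digit t] < beta t, the whole branch of digit a lies below t, so the cut
    puts no constraint on w. *)
Lemma reach_cons_lt (a : A) w t : 0 < t <= 1 -> (a < ceil_digit t)%N ->
  reach (a :: w) t <-> reach w 1.
Proof.
move=> t01 /natr_ord_succ act; have [qt _] := andP (ceil_digit_itv t01).
split=> -[y y0 /=].
- rewrite /greedy_word => -[_ yw]; exists (beta_map y) => //.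
  by apply: beta_map_itv; lra.
- by move=> yw; apply: reach_cons yw _ => //; lra.
Qed.

(** On the branch that meets the cut both maps are the same increasing affine map, so y < t becomes
    [beta_map y < ceil_map t]. *)
Lemma reach_cons_eq w t : 0 < t <= 1 ->
  reach (ceil_digit t :: w) t <-> reach w (ceil_map t).
Proof.
move=> t01; have [qt tq] := andP (ceil_digit_itv t01).
split=> -[y y0 /=].
- rewrite /greedy_word => -[fy yw]; exists (beta_map y) => //.
  have /beta_map_itv/andP[-> _] : 0 <= y < 1 by lra.
  rewrite /beta_map /ceil_map fy /= ltrD2r ltr_pM2l//; lra.
- by rewrite /ceil_map in y0; move=> yw; apply: reach_cons yw _; lra.
Qed.

Lemma reach_cons_le a w t : 0 < t <= 1 -> reach (a :: w) t ->
  (a <= ceil_digit t)%N.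
Proof.
move=> t01 [y y0 [fy _]]; rewrite leqNgt; apply/negP => /natr_ord_succ.
have /floor_digit_itv : 0 <= y < 1 by lra.
have [_] := andP (ceil_digit_itv t01).
have : beta * y < beta * t by rewrite ltr_pM2l//; lra.
rewrite fy; lra.
Qed.

Lemma reach_behead a w : reach (a :: w) 1 -> reach w 1.
Proof.
by move=> [y y01 [_ yw]]; exists (beta_map y) => //; exact: beta_map_itv.
Qed.

(** Induction on w: a smaller first digit leaves only reachability below 1, an equal one moves the
    cut to [ceil_map t], and a larger one is impossible. *)
Lemma reachP w t : reach w 1 -> 0 < t <= 1 ->
  reach w t <-> ((w : seqlexi A) <= quasi_word (size w) t)%O.
Proof.
elim: w t => [|a w IH] t w1 t01.
  split=> // _; exists 0 => //; lra.
rewrite /= lexi_cons; have w1' := reach_behead w1; split.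
- move=> wt; have := reach_cons_le t01 wt; rewrite leEord => ale.
  rewrite ale /=; apply/implyP => cla.
  have ac : a = ceil_digit t by apply/le_anti; rewrite leEord ale.
  move: wt; rewrite ac => /reach_cons_eq -/(_ t01).
  by move/(IH _ w1' (ceil_map_itv t01)).
- move=> /andP[]; rewrite !leEord leq_eqVlt => /orP[/eqP/val_inj -> | alt _].
    rewrite leqnn /= => wl; apply/reach_cons_eq => //.
    by apply/IH => //; exact: ceil_map_itv.
  exact/reach_cons_lt.
Qed.

(* The left shift by [size s] maps the cylinder of [s], cut at [t], onto an
   interval [0, t'), where [t'] belongs to an orbit of [ceil_map]. *)
Lemma reach_cat s t : 0 < t <= 1 -> reach s t ->
  exists2 t', (exists k, t' = iter k ceil_map t \/ t' = iter k ceil_map 1) &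
    forall w, reach (s ++ w) t <-> reach w t'.
Proof.
have l01 : 0 < (1 : R) <= 1 by rewrite ltr01 lexx.
elim: s t => [|a s IH] t t01 st; first by exists t => //; exists 0%N; left.
have := reach_cons_le t01 st.
rewrite leq_eqVlt => /orP[/eqP/val_inj ac|alt].
  move: st; rewrite ac => /(reach_cons_eq _ t01) st.
  have [t' [k kt'] wt'] := IH _ (ceil_map_itv t01) st.
  exists t'; last by move=> w; rewrite -wt'; exact: reach_cons_eq.
  by case: kt' => ->; [exists k.+1; left; rewrite iterSr | exists k; right].
(* A full branch resets the cut to 1, whence the second orbit in the statement. *)
move: st => /(reach_cons_lt _ t01 alt) st.
have [t' [k kt'] wt'] := IH _ l01 st.
exists t'; last by move=> w; rewrite -wt'; exact: reach_cons_lt.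
by exists k; right; case: kt'.
Qed.

(** Each digit of [quasi_word k t] selects the branch that meets the current cut, so every orbit
    point is realized as a cut. *)
Lemma reach_quasi_cat k w t : 0 < t <= 1 ->
  reach (quasi_word k t ++ w) t <-> reach w (iter k ceil_map t).
Proof.
elim: k t => [//|k IH] t t01 /=.
by rewrite reach_cons_eq// -iterS iterSr -IH//; exact: ceil_map_itv.
Qed.

Lemma reach_quasi k t : 0 < t <= 1 -> reach (quasi_word k t) t.
Proof.
move=> t01; rewrite -[quasi_word k t]cats0; apply/reach_quasi_cat => //.
by exists 0 => //; rewrite lexx /=; have /andP[] := iter_ceil_map_itv k t01.
Qed.

Lemma greedy_word_left n t : 0 < t <= 1 -> exists2 e, 0 <= e < t &
  forall y, e < y < t -> greedy_word n y = quasi_word n t.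
Proof.
elim: n t => [|n IH] t t01.
  by exists 0 => //; rewrite lexx; case/andP: t01.
have [e e0 ey] := IH _ (ceil_map_itv t01).
have [qt tq] := andP (ceil_digit_itv t01).
(* The preimage of e under the branch of digit [ceil_digit t]. *)
rewrite /ceil_map in e0; exists (((ceil_digit t)%:R + e) / beta).
  rewrite divr_ge0 ?(ltW beta_gt0)// ?addr_ge0//; last lra.
  by rewrite ltr_pdivrMr// mulrC; lra.
move=> y; rewrite ltr_pdivrMr// mulrC => /andP[ly].
rewrite -(ltr_pM2l beta_gt0) => yt.
have fd : floor_digit y = ceil_digit t by apply: floor_digit_eq; lra.
rewrite /greedy_word /= fd -/(greedy_word _ _) ey// /beta_map /ceil_map fd; lra.
Qed.

(** * Infinite expansions and the identification of [d_beta] *)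

Definition greedy_seq x : digit_seq (Num.truncn beta) :=
  fun k => floor_digit (iter k beta_map x).

Definition quasi_seq t : digit_seq (Num.truncn beta) :=
  fun k => ceil_digit (iter k ceil_map t).

Lemma mkseq_greedy x i n :
  mkseq (fun j => greedy_seq x (i + j)) n = greedy_word n (iter i beta_map x).
Proof.
apply: (@eq_from_nth _ ord0); first by rewrite size_mkseq size_greedy_word.
move=> k; rewrite size_mkseq => kn; rewrite nth_mkseq// /greedy_word.
rewrite (nth_map (iter i beta_map x)) ?size_traject// nth_traject//.
by rewrite -iterD addnC.
Qed.

Lemma mkseq_quasi t i n : mkseq (fun j => quasi_seq t (i + j)) n =
  quasi_word n (iter i ceil_map t).
Proof.
apply: (@eq_from_nth _ ord0); first by rewrite size_mkseq size_quasi_word.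
move=> k; rewrite size_mkseq => kn; rewrite nth_mkseq// /quasi_word.
rewrite (nth_map (iter i ceil_map t)) ?size_traject// nth_traject//.
by rewrite -iterD addnC.
Qed.

Local Notation terms s := (fun k => (s k : 'I__)%:R / beta ^+ k.+1).

Lemma series_greedy x n :
  series (terms (greedy_seq x)) n = x - iter n beta_map x / beta ^+ n.
Proof.
elim: n => [|n IH]; first by rewrite /series /= big_geq// expr0 divr1 subrr.
rewrite seriesSr IH iterS {2}/beta_map exprS.
have bn : beta ^+ n != 0 by rewrite expf_neq0// gt_eqF.
by field; rewrite bn gt_eqF.
Qed.

Lemma expands_greedy x : 0 <= x < 1 -> expands x (greedy_seq x).
Proof.
move=> x01; rewrite /expands.
rewrite (_ : series _ = fun n => x - iter n beta_map x / beta ^+ n); last first.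
  by apply/funext => n; exact: series_greedy.
suff c0 : (iter n beta_map x / beta ^+ n) @[n --> \oo] --> (0 : R).
  by have := cvgB (cvg_cst x) c0; rewrite subr0; apply.
apply: (@squeeze_cvgr _ _ _ _ (cst 0) (fun n => beta^-1 ^+ n)).
- apply: nearW => n; have /andP[T0 T1] := iter_beta_map_itv n x01.
  have bn : 0 < beta ^+ n by rewrite exprn_gt0.
  rewrite /cst divr_ge0 ?(ltW bn)//= exprVn -[leRHS]mul1r.
  by rewrite ler_wpM2r ?invr_ge0 ?(ltW bn) ?(ltW T1).
- exact: cvg_cst.
- by apply: cvg_expr; rewrite gtr0_norm ?invr_gt0// invf_lt1.
Qed.

(** If s had the larger digit at the first difference n, its partial sum through n would already
    exceed x, while partial sums of nonnegative terms stay below their limit. *)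
Lemma expands_le_greedy x s : 0 <= x < 1 -> expands x s ->
  lex_le s (greedy_seq x).
Proof.
move=> x01 sx; rewrite /lex_le /big_lexi_le.
case E : (first_diff _ _) => [n|//].
have [pre _] := (first_diff_SomeP _ _ _).1 E.
rewrite leqNgt; apply/negP => gs.
have pos k : 0 <= (s k : 'I__)%:R / beta ^+ k.+1.
  by rewrite divr_ge0// exprn_ge0// ltW.
have incr : nondecreasing_seq (series (terms s)).
  by apply/nondecreasing_seqP => k; rewrite seriesSr lerDl.
have := nondecreasing_cvgn_le incr (cvgP _ sx) n.+1.
have -> : limn (series (terms s)) = x by exact: (cvg_lim (@Rhausdorff R) sx).
apply/negP; rewrite -ltNge seriesSr.
have -> : series (terms s) n = series (terms (greedy_seq x)) n.
  rewrite !seriesEnat /= !big_mkord; apply: eq_bigr => i _.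
  by rewrite (pre i (ltn_ord i)).
(* The common prefix leaves the remainder [y / beta ^+ n]; it remains to see that beta y is less
   than the digit of s at n. *)
rewrite series_greedy exprS invfM mulrA.
set y := iter n beta_map x; have y01 : 0 <= y < 1 by exact: iter_beta_map_itv.
rewrite -addrA ltrDl addrC subr_gt0 ltr_pM2r ?invr_gt0 ?exprn_gt0//.
rewrite ltr_pdivlMr// mulrC.
have [_ /lt_le_trans] := andP (floor_digit_itv y01); apply.
by rewrite natr1 ler_nat.
Qed.

Lemma d_betaE x : 0 <= x < 1 -> d_beta beta x = greedy_seq x.
Proof.
move=> x01; apply: get_unique => [|s [sx smax]].
  by split=> [|t]; [exact: expands_greedy | exact: expands_le_greedy].
apply: (@big_lexi_le_anti (fun=> 'I__) (fun _ i j => (i <= j)%N)).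
  by move=> _ i j ij; apply/val_inj/anti_leq.
apply/andP; split; first exact: expands_le_greedy.
by apply: smax; exact: expands_greedy.
Qed.

(** * The language of the shift and the sequence [d_beta_star1] *)

Lemma greedy_occursP w x : 0 <= x < 1 -> occurs w (greedy_seq x) -> reach w 1.
Proof.
move=> x01 [i ->]; rewrite mkseq_greedy; exists (iter i beta_map x).
  exact: iter_beta_map_itv.
by rewrite size_greedy_word.
Qed.

Lemma language_beta_shiftP w :
  language (A := A) (beta_shift beta) w <-> reach w 1.
Proof.
split=> [[p cp [i wE]]|[y y01 yw]].
  (* A point of the closure agrees with some greedy expansion up to the end of the occurrence of
     w. *)
  have [_ [[x] + <-] xp] := cp _ (nbhs_cylinder p (i + size w)).
  rewrite /= in_itv /= => x01; apply: (greedy_occursP x01); exists i.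
  rewrite {1}wE; apply/eq_in_map => j; rewrite mem_iota /= => jw.
  by rewrite -xp ?d_betaE// ltn_add2l.
exists (d_beta beta y).
  by apply: subset_closure; exists y => //=; rewrite in_itv.
by exists 0%N; rewrite d_betaE// (mkseq_greedy y 0) yw.
Qed.

Lemma d_beta_star1E : d_beta_star1 beta = quasi_seq 1.
Proof.
apply: (cvg_lim (@digit_seq_hausdorff _)); apply: digit_seq_cvg => k.
suff: \forall x \near 1^'-, d_beta beta x k = quasi_seq 1 k by [].
(* Words of length k + 1 are needed to include the digit of index k. *)
have [|e /andP[e0 e1] ey] := greedy_word_left k.+1 (t := 1).
  by rewrite ltr01 lexx.
near=> x.
have ex : e < x by near: x; exact: nbhs_left_gt.
have x1 : x < 1 by near: x; exact: nbhs_left_lt.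
rewrite d_betaE ?x1 ?(le_trans e0 (ltW ex))//.
have := ey x; rewrite ex x1 -(mkseq_greedy x 0) -(mkseq_quasi 1 0).
by move=> /(_ isT)/(congr1 (nth ord0 ^~ k)); rewrite !nth_mkseq.
Unshelve. all: by end_near.
Qed.

(** * Predecessor sets and subwords of the orbit of 1 *)

Local Notation tail k := (iter k ceil_map 1).

Let tail_itv k : 0 < tail k <= 1.
Proof. by apply: iter_ceil_map_itv; rewrite ltr01 lexx. Qed.

(** Testing the predecessor [quasi_word k 1] isolates the cut [tail k]; conversely every predecessor
    s turns into a cut of this form. *)
Lemma predecessor_set_beta_shiftP w1 w2 :
  predecessor_set (A := A) (beta_shift beta) w1 =
  predecessor_set (A := A) (beta_shift beta) w2 <->
  forall k, reach w1 (tail k) <-> reach w2 (tail k).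
Proof.
have t01 := tail_itv 0; rewrite /= in t01.
split=> [P12 k|r12].
  rewrite -!reach_quasi_cat// -!language_beta_shiftP.
  have qL : language (A := A) (beta_shift beta) (quasi_word k 1).
    exact/language_beta_shiftP/reach_quasi.
  have := congr1 (fun P : set (seq A) => P (quasi_word k 1)) P12.
  rewrite /predecessor_set /= => PE; split=> [L1|L2].
    by have [] : language (A := A) (beta_shift beta) (quasi_word k 1) /\
      language (A := A) (beta_shift beta) (quasi_word k 1 ++ w2) by rewrite -PE.
  by have [] : language (A := A) (beta_shift beta) (quasi_word k 1) /\
    language (A := A) (beta_shift beta) (quasi_word k 1 ++ w1) by rewrite PE.
apply/seteqP; split=> s [Ls Lsw]; split=> //; move: Ls Lsw;
  rewrite !language_beta_shiftP => /(reach_cat t01)[t [k kt] st];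
  (* The initial cut is 1, so the two orbits coincide. *)
  rewrite !st; (have -> : t = tail k by case: kt); by rewrite r12.
Qed.

Lemma occurs_quasi_seqP n (w : n.-tuple A) :
  occurs w (quasi_seq 1) <-> exists k, tval w = quasi_word n (tail k).
Proof.
split=> -[k wE]; exists k.
  by rewrite wE mkseq_quasi size_tuple.
by rewrite wE size_quasi_word mkseq_quasi.
Qed.

Lemma reach_le w t u : t <= u -> reach w t -> reach w u.
Proof.
by move=> tu [y /andP[y0 yt] yw]; exists y; rewrite // y0 (lt_le_trans yt).
Qed.

Lemma reach_occurs_quasi n (w : n.-tuple A) :
  occurs w (quasi_seq 1) -> reach w 1.
Proof.
move=> /occurs_quasi_seqP[k ->]; have /andP[_ k1] := tail_itv k.
exact: reach_le k1 (reach_quasi _ (tail_itv k)).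
Qed.

Lemma reach_tailP n (w : n.-tuple A) k : reach w 1 ->
  reach w (tail k) <-> ((w : seqlexi A) <= quasi_word n (tail k))%O.
Proof. by move=> w1; rewrite reachP ?size_tuple. Qed.

Lemma predecessor_set_occurs n (w : n.-tuple A) : reach w 1 ->
  exists2 v : n.-tuple A, occurs v (quasi_seq 1) &
    predecessor_set (A := A) (beta_shift beta) w =
    predecessor_set (A := A) (beta_shift beta) v.
Proof.
move=> w1; pose q k := Tuple (introT eqP (size_quasi_word n (tail k))).
have qd k : occurs (q k) (quasi_seq 1) by apply/occurs_quasi_seqP; exists k.
(* The prefix of the quasi-greedy sequence dominates w, so a least subword v above w exists. *)
have wq0 : ((w : seqlexi A) <= q 0)%O by apply/(reach_tailP 0 w1).
pose above (v : n.-tuple A) :=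
  `[< occurs v (quasi_seq 1) >] && ((w : seqlexi A) <= v)%O.
have aboveP k : ((w : seqlexi A) <= q k)%O -> above (q k).
  by move=> wq; apply/andP; split=> //; exact/asboolP.
have [v /andP[/asboolP vd wv] vmin] :=
  arg_minP (fun v : n.-tuple A => (v : seqlexi A)) (aboveP 0 wq0).
exists v => //; apply/predecessor_set_beta_shiftP => k.
have v1 := reach_occurs_quasi vd.
(* A subword above w is above v by minimality, and conversely by transitivity through w <= v. *)
rewrite !reach_tailP//; split=> [/aboveP/vmin //|]; exact: le_trans.
Qed.

(** Each word is reachable below the cut at which it occurs; equal predecessor sets transfer this to
    the other word, giving both lexicographic inequalities. *)
Lemma predecessor_set_occurs_inj n (v w : n.-tuple A) :
  occurs v (quasi_seq 1) -> occurs w (quasi_seq 1) ->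
  predecessor_set (A := A) (beta_shift beta) v =
  predecessor_set (A := A) (beta_shift beta) w -> v = w.
Proof.
move=> vd wd /predecessor_set_beta_shiftP vw.
have [v1 w1] := (reach_occurs_quasi vd, reach_occurs_quasi wd).
have [i vE] := (occurs_quasi_seqP v).1 vd.
have [j wE] := (occurs_quasi_seqP w).1 wd.
apply/val_inj/(@le_anti _ (seqlexi A)); apply/andP; split.
  rewrite /= wE; apply/reach_tailP => //; apply/vw/reach_tailP => //.
  by rewrite wE.
rewrite /= vE; apply/reach_tailP => //; apply/vw/reach_tailP => //.
by rewrite vE.
Qed.

(** Reindexes the predecessor sets by subwords, where the indexing is injective and cardinalities
    can be compared. *)
Lemma predecessor_sets_beta_shift n :
  predecessor_sets (A := A) (beta_shift beta) n =
  [fset predecessor_set (A := A) (beta_shift beta) (tval w)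
    | w in [pred w : n.-tuple A | `[< occurs w (quasi_seq 1) >]]]%fset.
Proof.
apply/fsetP => P; apply/imfsetP/imfsetP => -[w /= /asboolP Lw ->].
  have [v vd vP] := predecessor_set_occurs ((language_beta_shiftP w).1 Lw).
  by exists v => //=; apply/asboolP.
exists w => //=; apply/asboolP/language_beta_shiftP.
exact: reach_occurs_quasi.
Qed.

End Expansions.

Theorem theorem3p11 (R : realType) (beta : R) (hbeta : 1 < beta)
    (n : nat) (hn : (0 < n)%N) :
  predecessor_set_sequence (A := 'I_(Num.truncn beta).+1) (beta_shift beta) n =
  complexity (A := 'I_(Num.truncn beta).+1) (d_beta_star1 beta) n.
Proof.
rewrite /predecessor_set_sequence predecessor_sets_beta_shift// /complexity.
rewrite d_beta_star1E// card_in_imfset /= -?cardE//.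
move=> v w /asboolP vd /asboolP wd; exact: predecessor_set_occurs_inj.
Qed.
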